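(* A sequent is derivable in the (cut-free) calculus $\mathbf{L}^{\!+}_{\omega}(\vee)$ if and only if it is derivable in the (cut-free) calculus $\mathbf{L}^{\!+}_{\infty}(\vee)$.
   Context: Types are built from a countable set of variables (primitive types) using binary connectives $\cdot$, $\backslash$, $/$, $\vee$ and a unary connective ${}^+$ (written $A^+$). Capital Latin letters denote types; capital Greek letters denote finite (possibly empty) sequences of types. A sequent is $\Pi\to A$ with $A$ a type and $\Pi$ a non-empty finite sequence of types; all sequents, including those in rules, must have a non-empty left-hand side. Both calculi contain: axioms $A\to A$; $(\to\backslash)$: from $A,\Pi\to B$ infer $\Pi\to A\backslash B$ ($\Pi$ non-empty); $(\backslash\to)$: from $\Pi\to A$ and $\Gamma,B,\Delta\to C$ infer $\Gamma,\Pi,A\backslash B,\Delta\to C$; $(\to/)$: from $\Pi,A\to B$ infer $\Pi\to B/A$ ($\Pi$ non-empty); $(/\to)$: from $\Pi\to A$ and $\Gamma,B,\Delta\to C$ infer $\Gamma,B/A,\Pi,\Delta\to C$; $(\to\cdot)$: from $\Gamma\to A$ and $\Delta\to B$ infer $\Gamma,\Delta\to A\cdot B$; $(\cdot\to)$: from $\Gamma,A,B,\Delta\to C$ infer $\Gamma,A\cdot B,\Delta\to C$; $(\vee\to)$: from $\Gamma,A_1,\Delta\to C$ and $\Gamma,A_2,\Delta\to C$ infer $\Gamma,A_1\vee A_2,\Delta\to C$; $(\to\vee)$: from $\Gamma\to A_i$ infer $\Gamma\to A_1\vee A_2$ ($i=1,2$). Neither calculus contains the cut rule. $\mathbf{L}^{\!+}_{\omega}(\vee)$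 additionally has: $(\to{}^+)_n$ for each $n\ge1$: from $\Pi_1\to A,\dots,\Pi_n\to A$ infer $\Pi_1,\dots,\Pi_n\to A^+$; and the $\omega$-rule $({}^+\to)_\omega$: from the infinitely many premises $\Gamma,A,\Delta\to C$; $\Gamma,A,A,\Delta\to C$; $\Gamma,A,A,A,\Delta\to C$; $\dots$ infer $\Gamma,A^+,\Delta\to C$. Derivations are well-founded (possibly infinitely branching) trees. $\mathbf{L}^{\!+}_{\infty}(\vee)$ additionally has: $(\to{}^+)_1$: from $\Pi\to A$ infer $\Pi\to A^+$; $(\to{}^+)_{\mathrm L}$: from $\Pi_1\to A$ and $\Pi_2\to A^+$ infer $\Pi_1,\Pi_2\to A^+$; $({}^+\to)_{\mathrm L}$: from $\Gamma,A,\Delta\to C$ and $\Gamma,A,A^+,\Delta\to C$ infer $\Gamma,A^+,\Delta\to C$. Derivations in $\mathbf{L}^{\!+}_{\infty}(\vee)$ are arbitrary, possibly infinitely deep, (finitely branching) trees of sequents in which every node is either an axiom (a leaf) or is obtained from its children by one of the rules; infinite paths are allowed. *)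

(* Defs.v *)
(* Stdlib world. *)
From Stdlib Require Export List.
Export ListNotations.

Inductive type : Set :=
| Var (i : nat)
| Prod (A B : type)    (* A . B *)
| Under (A B : type)   (* A \ B : the argument A is on the left *)
| Over (B A : type)    (* B / A : the argument A is on the right *)
| Join (A B : type)    (* A \/ B *)
| Plus (A : type).     (* A^+ *)

Record sequent : Set := Sequent { antecedent : list type; succedent : type }.

Notation "G ==> C" := (Sequent G C) (at level 70, no associativity).

(* [lambek_join_rule ps s]: from the list [ps] of premises infer [s].
   Non-emptiness of antecedents is not imposed here but on every node of a
   derivation, see [wf_derivable] and [nwf_derivable]. *)
Inductive lambek_join_rule : list sequent -> sequent -> Prop :=
| axiom_rule A :
    lambek_join_rule [] ([A] ==> A)
| under_right P A B :
    lambek_join_rule [A :: P ==> B] (P ==> Under A B)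
| under_left G P D A B C :
    lambek_join_rule [P ==> A; G ++ [B] ++ D ==> C]
                     (G ++ P ++ [Under A B] ++ D ==> C)
| over_right P A B :
    lambek_join_rule [P ++ [A] ==> B] (P ==> Over B A)
| over_left G P D A B C :
    lambek_join_rule [P ==> A; G ++ [B] ++ D ==> C]
                     (G ++ [Over B A] ++ P ++ D ==> C)
| prod_right G D A B :
    lambek_join_rule [G ==> A; D ==> B] (G ++ D ==> Prod A B)
| prod_left G D A B C :
    lambek_join_rule [G ++ [A; B] ++ D ==> C] (G ++ [Prod A B] ++ D ==> C)
| join_left G D A1 A2 C :
    lambek_join_rule [G ++ [A1] ++ D ==> C; G ++ [A2] ++ D ==> C]
                     (G ++ [Join A1 A2] ++ D ==> C)
| join_right1 G A1 A2 :
    lambek_join_rule [G ==> A1] (G ==> Join A1 A2)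
| join_right2 G A1 A2 :
    lambek_join_rule [G ==> A2] (G ==> Join A1 A2).

(* A rule system relates a possibly infinite set of premises to a conclusion. *)
Definition rule_system : Type := (sequent -> Prop) -> sequent -> Prop.

Inductive omega_rule : rule_system :=
| omega_base ps s :
    lambek_join_rule ps s -> omega_rule (fun p => In p ps) s
| omega_plus_right (Ps : list (list type)) A :
    Ps <> [] ->
    omega_rule (fun p => exists P, In P Ps /\ p = (P ==> A))
               (concat Ps ==> Plus A)
| omega_plus_left G D A C :
    omega_rule (fun p => exists n, 1 <= n /\ p = (G ++ repeat A n ++ D ==> C))
               (G ++ [Plus A] ++ D ==> C).

Inductive infty_finite_rule : list sequent -> sequent -> Prop :=
| infty_base ps s :
    lambek_join_rule ps s -> infty_finite_rule ps s
| infty_plus_right1 P A :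
    infty_finite_rule [P ==> A] (P ==> Plus A)
| infty_plus_rightL P1 P2 A :
    infty_finite_rule [P1 ==> A; P2 ==> Plus A] (P1 ++ P2 ==> Plus A)
| infty_plus_leftL G D A C :
    infty_finite_rule [G ++ [A] ++ D ==> C; G ++ [A; Plus A] ++ D ==> C]
                      (G ++ [Plus A] ++ D ==> C).

Inductive infty_rule : rule_system :=
| infty_rule_intro ps s :
    infty_finite_rule ps s -> infty_rule (fun p => In p ps) s.

(* Well-founded derivations, possibly infinitely branching. *)
Inductive wf_derivable (R : rule_system) (s : sequent) : Prop :=
| wf_node (premises : sequent -> Prop) :
    antecedent s <> [] ->
    R premises s ->
    (forall p, premises p -> wf_derivable R p) ->
    wf_derivable R s.

(* Derivations of arbitrary, possibly infinite, depth. *)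
CoInductive nwf_derivable (R : rule_system) (s : sequent) : Prop :=
| nwf_node (premises : sequent -> Prop) :
    antecedent s <> [] ->
    R premises s ->
    (forall p, premises p -> nwf_derivable R p) ->
    nwf_derivable R s.

Definition derivable_omega : sequent -> Prop := wf_derivable omega_rule.

Definition derivable_infty : sequent -> Prop := nwf_derivable infty_rule.

(* Main.v *)
(* From omega to infinity, the omega-rule is simulated by an infinite branch
   that unfolds A^+ forever.  Conversely, a non-well-founded derivation is
   consumed by well-founded recursion on the Dershowitz-Manna order of the
   multiset of types of the sequent: every premise in the omega-calculus is
   smaller than its conclusion.  The recursion is applied to sequents in which
   some occurrences of types A^+ in the antecedent of an infinitarily derivable
   sequent have been replaced by positive numbers of copies of A; this
   contains the invertibility of the left rules for ^+.  The tail premise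
   P2 -> A^+ of (-> ^+)_L is smaller because P1 is non-empty, and the rule
   itself is admissible in the omega-calculus. *)
From Stdlib Require Import Permutation Wellfounded PeanoNat Lia.
Require Import Defs.

(** * Well-foundedness of the Dershowitz-Manna order on finite multisets *)

Section MultisetOrder.

Context {T : Type} (R : T -> T -> Prop).

(* One element [a] is replaced by smaller ones, and [Y] is dropped. *)
Definition multiset_lt (M N : list T) : Prop :=
  exists a K X Y,
    Permutation N (a :: X ++ Y) /\ Permutation M (K ++ X) /\
    Forall (fun k => R k a) K.

Lemma multiset_lt_app_r M N Y : multiset_lt M N -> multiset_lt M (N ++ Y).
Proof.
  intros (a & K & X & Z & HN & HM & HK).
  exists a, K, X, (Z ++ Y). repeat split; auto.
  rewrite HN, app_assoc. reflexivity.
Qed.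

Lemma Acc_multiset_perm M N :
  Permutation M N -> Acc multiset_lt M -> Acc multiset_lt N.
Proof.
  intros HMN HM. constructor. intros L (a & K & X & Y & HN & HL & HK).
  apply (Acc_inv HM). exists a, K, X, Y. rewrite HMN. auto.
Qed.

Lemma Acc_multiset_prefix M Y : Acc multiset_lt (M ++ Y) -> Acc multiset_lt M.
Proof.
  intros H. constructor. intros L HL.
  apply (Acc_inv H), multiset_lt_app_r, HL.
Qed.

(** Nested induction, outer on [a] and inner on [X]: a step down from [a :: X] either replaces [a],
    keeps it, or drops it. *)
Lemma Acc_multiset_cons a :
  Acc R a -> forall X, Acc multiset_lt X -> Acc multiset_lt (a :: X).
Proof.
  induction 1 as [a _ IHa]. induction 1 as [X HX IHX].
  constructor. intros M (b & K & X' & Y & HN & HM & HK).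
  apply (Acc_multiset_perm (K ++ X')); [symmetry; exact HM|].
  assert (Ha : In a (b :: X' ++ Y)) by (rewrite <- HN; left; reflexivity).
  destruct Ha as [-> | Ha].
  (* [a] is replaced: the remainder [X'] is accessible as part of [X], and the elements of [K] are
     added one by one by the outer hypothesis. *)
  - apply Permutation_cons_inv in HN.
    assert (HX' : Acc multiset_lt X').
    { apply Acc_multiset_prefix with Y.
      apply (Acc_multiset_perm X); [exact HN | constructor; exact HX]. }
    clear HM. induction HK as [|k K Hk _ IHK]; simpl; auto.
  (* Either [a] is kept and the step takes place inside [X], or [a] is dropped and the result is
     already below [X]. *)
  - apply in_app_or in Ha as [Ha | Ha];
      apply in_split in Ha as (Z1 & Z2 & ->).
    + apply (Acc_multiset_perm (a :: K ++ Z1 ++ Z2)).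
      { rewrite !app_assoc. apply Permutation_middle. }
      apply IHX. exists b, K, (Z1 ++ Z2), Y. repeat split; auto.
      apply (Permutation_cons_inv (a := a)). rewrite HN, perm_swap.
      constructor. rewrite <- !app_assoc. simpl. symmetry. apply Permutation_middle.
    + apply HX. exists b, K, X', (Z1 ++ Z2). repeat split; auto.
      apply (Permutation_cons_inv (a := a)). rewrite HN, perm_swap.
      constructor. rewrite !app_assoc. symmetry. apply Permutation_middle.
Qed.

Lemma multiset_lt_wf : well_founded R -> well_founded multiset_lt.
Proof.
  intros HR M. induction M as [|a M IHM].
  - constructor. intros L (a & K & X & Y & HN & _).
    apply Permutation_nil in HN. discriminate.
  - apply Acc_multiset_cons; auto.
Qed.

End MultisetOrder.

(** * Sequents ordered by the multiset of their types *)

Fixpoint type_size (A : type) : nat :=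
  match A with
  | Var _ => 0
  | Prod A B | Under A B | Over A B | Join A B => S (type_size A + type_size B)
  | Plus A => S (type_size A)
  end.

Lemma type_eq_dec (A B : type) : {A = B} + {A <> B}.
Proof. decide equality; apply Nat.eq_dec. Qed.

(** Both sides of the arrow are counted together because rules move types across it, as
    [under_right] does with [A]. *)
Definition sequent_types (s : sequent) : list type :=
  succedent s :: antecedent s.

Definition sequent_lt (s t : sequent) : Prop :=
  multiset_lt (fun A B => type_size A < type_size B)
    (sequent_types s) (sequent_types t).

Lemma sequent_lt_wf : well_founded sequent_lt.
Proof.
  unfold sequent_lt.
  apply (wf_inverse_image _ _ (multiset_lt _)), multiset_lt_wf.
  apply (wf_inverse_image _ _ lt type_size), Nat.lt_wf_0.
Qed.

Ltac solve_perm :=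
  apply (Permutation_count_occ type_eq_dec); intro;
  unfold sequent_types; simpl;
  repeat (rewrite ?count_occ_app; simpl);
  repeat (match goal with |- context [type_eq_dec ?x ?y] =>
            destruct (type_eq_dec x y) end);
  lia.

Ltac solve_lt a K X Y :=
  exists a, K, X, Y; split; [solve_perm | split; [solve_perm |]];
  repeat apply Forall_cons; simpl; try lia; apply Forall_nil.

(** The principal type gives way to immediate subtypes; whatever goes only to the other premise is
    dropped. *)
Lemma lambek_join_premise_lt ps s p :
  lambek_join_rule ps s -> In p ps -> sequent_lt p s.
Proof.
  intros H Hp. destruct H; simpl in Hp;
    repeat (destruct Hp as [<- | Hp]; [| try contradiction]);
    try contradiction.
  - solve_lt (Under A B) [A; B] P (@nil type).
  - solve_lt (Under A B) [A] P (C :: G ++ D).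
  - solve_lt (Under A B) [B] (C :: G ++ D) P.
  - solve_lt (Over B A) [A; B] P (@nil type).
  - solve_lt (Over B A) [A] P (C :: G ++ D).
  - solve_lt (Over B A) [B] (C :: G ++ D) P.
  - solve_lt (Prod A B) [A] G D.
  - solve_lt (Prod A B) [B] D G.
  - solve_lt (Prod A B) [A; B] (C :: G ++ D) (@nil type).
  - solve_lt (Join A1 A2) [A1] (C :: G ++ D) (@nil type).
  - solve_lt (Join A1 A2) [A2] (C :: G ++ D) (@nil type).
  - solve_lt (Join A1 A2) [A1] G (@nil type).
  - solve_lt (Join A1 A2) [A2] G (@nil type).
Qed.

(** The number of copies is unbounded, so a sum of sizes would not decrease; in the multiset order
    each copy only has to be smaller than [Plus A]. *)
Lemma plus_left_premise_lt G D A C n :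
  sequent_lt (G ++ repeat A n ++ D ==> C) (G ++ [Plus A] ++ D ==> C).
Proof.
  exists (Plus A), (repeat A n), (C :: G ++ D), []. split; [solve_perm|].
  split; [solve_perm|].
  apply Forall_forall. intros k Hk. apply repeat_spec in Hk as ->. simpl. lia.
Qed.

Lemma plus_right_head_lt P Q A : sequent_lt (P ==> A) (P ++ Q ==> Plus A).
Proof. solve_lt (Plus A) [A] P Q. Qed.

Lemma plus_right_tail_lt P Q A :
  P <> [] -> sequent_lt (Q ==> Plus A) (P ++ Q ==> Plus A).
Proof.
  destruct P as [|B P]; [easy|]. intros _.
  (* [Plus A] stays, so the decrease comes from the prefix: its first type [B] is replaced by
     nothing. *)
  solve_lt B (@nil type) (Plus A :: Q) P.
Qed.

(** * Partial expansion of iterated types in an antecedent *)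

(* [expand k l m]: [m] is [l] with some occurrences of types [Plus A] replaced
   by positive numbers of copies of [A], [k] copies in total. *)
Inductive expand : nat -> list type -> list type -> Prop :=
| expand_nil : expand 0 [] []
| expand_keep k A l m : expand k l m -> expand k (A :: l) (A :: m)
| expand_plus k n A l m :
    expand k l m -> expand (S n + k) (Plus A :: l) (repeat A (S n) ++ m).

Lemma expand_refl l : expand 0 l l.
Proof. induction l; constructor; auto. Qed.

Lemma expand_app k1 k2 l1 l2 m1 m2 :
  expand k1 l1 m1 -> expand k2 l2 m2 -> expand (k1 + k2) (l1 ++ l2) (m1 ++ m2).
Proof.
  intros H1 H2. induction H1.
  - exact H2.
  - apply expand_keep, IHexpand.
  - rewrite <- app_assoc, <- Nat.add_assoc. apply expand_plus, IHexpand.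
Qed.

Lemma expand_app_inv k l1 l2 m :
  expand k (l1 ++ l2) m ->
  exists k1 k2 m1 m2,
    k = k1 + k2 /\ m = m1 ++ m2 /\ expand k1 l1 m1 /\ expand k2 l2 m2.
Proof.
  revert k m. induction l1 as [|A l1 IH]; simpl; intros k m H.
  - exists 0, k, [], m. repeat split; auto using expand_nil.
  - inversion H; subst;
      match goal with HE : expand _ (l1 ++ l2) _ |- _ =>
        destruct (IH _ _ HE) as (k1 & k2 & m1 & m2 & -> & -> & H1 & H2) end.
    + exists k1, k2, (A :: m1), m2. repeat split; auto using expand_keep.
    + exists (S n + k1), k2, (repeat A0 (S n) ++ m1), m2.
      rewrite app_assoc, Nat.add_assoc.
      repeat split; auto using expand_plus.
Qed.

Lemma expand_neq_nil k l m : expand k l m -> l <> [] -> m <> [].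
Proof. intros []; easy. Qed.

(** * Non-empty antecedents and derived rules of the omega-calculus *)

Lemma wf_derivable_neq_nil R P C : wf_derivable R (P ==> C) -> P <> [].
Proof. intros []; assumption. Qed.

Lemma nwf_derivable_neq_nil R P C : nwf_derivable R (P ==> C) -> P <> [].
Proof. intros []; assumption. Qed.

Lemma app_neq_nil_l {T : Type} (l m : list T) : l <> [] -> l ++ m <> [].
Proof. destruct l; easy. Qed.

Lemma app_neq_nil_r {T : Type} (l m : list T) : m <> [] -> l ++ m <> [].
Proof. destruct l; easy. Qed.

Lemma omega_lambek_join ps P C :
  P <> [] -> lambek_join_rule ps (P ==> C) ->
  Forall derivable_omega ps -> derivable_omega (P ==> C).
Proof.
  intros HP Hr Hps. apply wf_node with (fun p => In p ps); auto.
  - apply omega_base, Hr.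
  - apply Forall_forall, Hps.
Qed.

Lemma omega_axiom A : derivable_omega ([A] ==> A).
Proof. eapply omega_lambek_join; [easy | apply axiom_rule | auto]. Qed.

Lemma omega_plus_left_intro G D A C :
  (forall n, derivable_omega (G ++ repeat A (S n) ++ D ==> C)) ->
  derivable_omega (G ++ [Plus A] ++ D ==> C).
Proof.
  intros H. eapply wf_node.
  - apply app_neq_nil_r. easy.
  - apply omega_plus_left.
  - intros p ([|n] & Hn & ->); [lia | apply H].
Qed.

Lemma omega_plus_right_intro Ps A :
  Ps <> [] -> (forall P, In P Ps -> derivable_omega (P ==> A)) ->
  derivable_omega (concat Ps ==> Plus A).
Proof.
  intros HPs H. eapply wf_node.
  - destruct Ps as [|P Ps]; [easy|]. apply app_neq_nil_l.
    eapply wf_derivable_neq_nil, H. left. reflexivity.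
  - apply omega_plus_right, HPs.
  - intros p (P & HP & ->). apply H, HP.
Qed.

Lemma concat_repeat_singleton {T : Type} (a : T) n :
  concat (repeat [a] n) = repeat a n.
Proof. induction n; simpl; congruence. Qed.

Lemma omega_repeat_plus A n : derivable_omega (repeat A (S n) ==> Plus A).
Proof.
  rewrite <- concat_repeat_singleton. apply omega_plus_right_intro; [easy|].
  intros P HP. apply repeat_spec in HP as ->. apply omega_axiom.
Qed.

(* The left rules permute below, hence the induction on the second premise. *)
Lemma omega_plus_right_cons P Q A :
  derivable_omega (P ==> A) -> derivable_omega (Q ==> Plus A) ->
  derivable_omega (P ++ Q ==> Plus A).
Proof.
  intros HP HQ. pose proof (wf_derivable_neq_nil _ _ _ HP) as HPn.
  remember (Q ==> Plus A) as s eqn:Es. revert Q Es.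
  induction HQ as [s prem _ Hr Hprem IH]. intros Q ->.
  assert (HPQ : P ++ Q <> []) by (apply app_neq_nil_l, HPn).
  inversion Hr as [ps s Hb | Ps B HPs | G D B C]; subst.
  - inversion Hb; subst.
    (* The axiom has no premise to recurse into: the omega-rule unfolds [Plus A], and the result
       splits into [P] and singleton blocks [[A]]. *)
    + change (P ++ [Plus A]) with (P ++ [Plus A] ++ []).
      apply omega_plus_left_intro. intros n. rewrite app_nil_r.
      rewrite <- concat_repeat_singleton.
      change (P ++ concat ?L) with (concat (P :: L)).
      apply omega_plus_right_intro; [easy|].
      intros L [<- | HL]; [exact HP|].
      apply repeat_spec in HL as ->. apply omega_axiom.
    + rewrite (app_assoc P G) in *.
      eapply omega_lambek_join; [assumption | apply under_left |].
      repeat constructor; [apply Hprem; simpl; auto |].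
      rewrite <- app_assoc. eapply IH; [|reflexivity]. simpl; auto.
    + rewrite (app_assoc P G) in *.
      eapply omega_lambek_join; [assumption | apply over_left |].
      repeat constructor; [apply Hprem; simpl; auto |].
      rewrite <- app_assoc. eapply IH; [|reflexivity]. simpl; auto.
    + rewrite (app_assoc P G) in *.
      eapply omega_lambek_join; [assumption | apply prod_left |].
      repeat constructor.
      rewrite <- app_assoc. eapply IH; [|reflexivity]. simpl; auto.
    + rewrite (app_assoc P G) in *.
      eapply omega_lambek_join; [assumption | apply join_left |].
      repeat constructor;
        rewrite <- app_assoc; (eapply IH; [|reflexivity]); simpl; auto.
  - change (P ++ concat Ps) with (concat (P :: Ps)).
    apply omega_plus_right_intro; [easy|].
    intros L [<- | HL]; [exact HP|]. apply Hprem. eauto.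
  - rewrite app_assoc. apply omega_plus_left_intro. intros n.
    rewrite <- app_assoc. eapply IH; [|reflexivity].
    exists (S n). split; [lia | reflexivity].
Qed.

(** * From the infinitary calculus to the omega-calculus *)

Ltac invert_expand :=
  repeat match goal with
  | H : expand _ (_ ++ _) _ |- _ =>
      apply expand_app_inv in H as (? & ? & ? & ? & -> & -> & ? & H)
  | H : expand _ (_ :: _) _ |- _ => inversion H; subst; clear H
  | H : expand _ [] _ |- _ => inversion H; subst; clear H
  end.

Ltac build_expand :=
  repeat first [eassumption | apply expand_refl | apply expand_keep
               | apply expand_app].

(** Lexicographic induction on [s] and then on [k]. The second component handles left rules at an
    occurrence already expanded, where [s] does not change. *)
Lemma infty_expand_omega s :
  forall k l, expand k l (antecedent s) ->
  derivable_infty (l ==> succedent s) -> derivable_omega s.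
Proof.
  induction (sequent_lt_wf s) as [[m C] _ IH]. simpl.
  assert (IH' : forall m' C' k l, expand k l m' ->
    derivable_infty (l ==> C') -> sequent_lt (m' ==> C') (m ==> C) ->
    derivable_omega (m' ==> C')) by (intros; eapply IH; eauto).
  clear IH. intros k. induction (Nat.lt_wf_0 k) as [k _ IHk].
  intros l Hl [prem Hn Hr Hprem]. simpl in Hn.
  pose proof (expand_neq_nil _ _ _ Hl Hn) as Hm.
  assert (base : forall ps, lambek_join_rule ps (m ==> C) ->
    Forall (fun p => exists l, derivable_infty (l ==> succedent p) /\
      exists k, expand k l (antecedent p)) ps -> derivable_omega (m ==> C)).
  { intros ps Hps Hall. eapply omega_lambek_join; [exact Hm | exact Hps |].
    rewrite Forall_forall in *. intros [m' C'] Hp.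
    destruct (Hall _ Hp) as (l' & Hl' & k' & Hk').
    eapply IH'; eauto using lambek_join_premise_lt. }
  inversion Hr as [ps s Hf]; subst.
  inversion Hf as [ps' s Hb | P A | P1 P2 A | G D A B]; subst.
  - inversion Hb; subst; invert_expand;
      try (eapply base; [solve [constructor] |];
           repeat apply Forall_cons; try apply Forall_nil;
           (eexists; split;
           [ apply Hprem; (left; reflexivity) + (right; left; reflexivity)
           | eexists; simpl; solve [build_expand] ])).
    (* The remaining case is the axiom on [Plus A] with its left side expanded, which is no longer
       an axiom. *)
    rewrite app_nil_r. apply omega_repeat_plus.
  - rewrite <- (app_nil_r m). change (m ++ []) with (concat [m]).
    apply omega_plus_right_intro; [easy|]. intros L [<- | []].
    eapply IH'; [exact Hl | apply Hprem; left; reflexivity |].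
    rewrite <- (app_nil_r m) at 2. apply plus_right_head_lt.
  - apply expand_app_inv in Hl as (k1 & k2 & m1 & m2 & -> & -> & Hl1 & Hl2).
    assert (Hm1 : m1 <> []).
    { eapply expand_neq_nil; [exact Hl1|].
      eapply nwf_derivable_neq_nil, Hprem. left. reflexivity. }
    apply omega_plus_right_cons.
    + eapply IH'; [exact Hl1 | apply Hprem; left; reflexivity |].
      apply plus_right_head_lt.
    + eapply IH'; [exact Hl2 | apply Hprem; right; left; reflexivity |].
      apply plus_right_tail_lt, Hm1.
  - apply expand_app_inv in Hl as (k1 & k2 & m1 & m2 & -> & -> & Hl1 & Hl2).
    inversion Hl2 as [| k' A' l m' Hl' | k' n A' l m' Hl']; subst.
    (* [Plus A] is still unexpanded: each premise of the omega-rule expands the conclusion of the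
       same infinitary node, not one of its premises. *)
    + apply (omega_plus_left_intro m1 m' A). intros n.
      eapply IH'.
      * apply expand_app; [exact Hl1|].
        apply expand_plus, Hl'.
      * econstructor; eauto.
      * apply plus_left_premise_lt.
    (* A single copy selects the left premise, several select the right one; either way the first
       copy becomes a literal [A] and [k] drops by one. *)
    + destruct n as [|n].
      * eapply IHk; [| | apply Hprem; left; reflexivity].
        2: { apply expand_app; [exact Hl1|]. apply expand_keep, Hl'. }
        lia.
      * eapply IHk; [| | apply Hprem; right; left; reflexivity].
        2: { apply expand_app; [exact Hl1|].
             apply (expand_keep _ A), expand_plus, Hl'. }
        lia.
Qed.

(** * From the omega-calculus to the infinitary calculus *)

Lemma infty_intro ps P C :
  P <> [] -> infty_finite_rule ps (P ==> C) ->
  Forall derivable_infty ps -> derivable_infty (P ==> C).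
Proof.
  intros HP Hr Hps. apply nwf_node with (fun p => In p ps); auto.
  - apply infty_rule_intro, Hr.
  - apply Forall_forall, Hps.
Qed.

(** A chain of [infty_plus_rightL] steps splits off the blocks, and [infty_plus_right1] closes it at
    the last one. *)
Lemma infty_plus_right_concat Ps A :
  Ps <> [] -> (forall P, In P Ps -> derivable_infty (P ==> A)) ->
  derivable_infty (concat Ps ==> Plus A).
Proof.
  intros HPs H. induction Ps as [|P Ps IH]; [easy|].
  assert (HP : derivable_infty (P ==> A)) by (apply H; left; reflexivity).
  pose proof (nwf_derivable_neq_nil _ _ _ HP) as HPn.
  destruct Ps as [|Q Ps].
  - simpl. rewrite app_nil_r.
    eapply infty_intro; [exact HPn | apply infty_plus_right1 | auto].
  - change (concat (P :: ?L)) with (P ++ concat L).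
    eapply infty_intro;
      [apply app_neq_nil_l, HPn | apply infty_plus_rightL |].
    repeat constructor; [exact HP|].
    apply IH; [easy|]. intros L HL. apply H. right. exact HL.
Qed.

(* [n] counts the copies of [A] already produced; stating the conclusion with
   an equation keeps the corecursive calls guarded. *)
Lemma infty_plus_left G D A C n s :
  (forall n, derivable_infty (G ++ repeat A (S n) ++ D ==> C)) ->
  s = ((G ++ repeat A n) ++ [Plus A] ++ D ==> C) -> derivable_infty s.
Proof.
  intros H. revert n s. cofix IH. intros n s Hs.
  assert (E : G ++ repeat A (S n) = (G ++ repeat A n) ++ [A]).
  { rewrite <- app_assoc, <- repeat_cons. reflexivity. }
  apply nwf_node with
    (fun p => In p [(G ++ repeat A n) ++ [A] ++ D ==> C;
                    (G ++ repeat A n) ++ [A; Plus A] ++ D ==> C]).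
  - subst s. apply app_neq_nil_r. easy.
  - subst s. apply infty_rule_intro, infty_plus_leftL.
  - intros p [Hp | [Hp | []]].
    + rewrite <- Hp, app_assoc, <- E, <- app_assoc. apply H.
    (* The new [A] joins the left context, so the right premise has the form of the conclusion with
       [S n]. *)
    + apply (IH (S n)). rewrite <- Hp, E, <- (app_assoc _ [A]). reflexivity.
Qed.

Lemma omega_infty s : derivable_omega s -> derivable_infty s.
Proof.
  induction 1 as [s prem Hn Hr _ IH].
  destruct Hr as [ps [P C] Hb | Ps A HPs | G D A C].
  - apply infty_intro with ps; auto using infty_base.
    apply Forall_forall, IH.
  - apply infty_plus_right_concat; [exact HPs|].
    intros P HP. apply IH. eauto.
  - apply infty_plus_left with (G := G) (D := D) (A := A) (C := C) (n := 0).
    + intros n. apply IH. exists (S n). split; [lia | reflexivity].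
    + rewrite app_nil_r. reflexivity.
Qed.

Theorem proposition1 (Pi : list type) (C : type) (hPi : Pi <> []) :
  derivable_omega (Pi ==> C) <-> derivable_infty (Pi ==> C).
Proof.
  split.
  - apply omega_infty.
  - apply (infty_expand_omega (Pi ==> C) 0 Pi), expand_refl.
Qed.
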